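(* Consider the linear program $F(A,b,\ell,u,c)$ with $A\in\mathbb{R}^{V\times W}$, $b\in\mathbb{R}^V$, $c\in\mathbb{R}^W$ and vectors $\ell,u$ with $\ell_w\in\mathbb{R}\cup\{-\infty\}$, $u_w\in\mathbb{R}\cup\{\infty\}$ and $\ell_w\le u_w$ for all $w\in W$, and let $\delta\in\mathbb{R}^W$ satisfy $\ell\le\delta\le u$. Let $(\widehat{\mathcal P},\widehat{\mathcal Q})$ be a symmetric equitable partition of the split reformulation $F_S(A,b-A\delta,\ell-\delta,u-\delta,c)$, with associated sets $V_U\subseteq V$ and $W_U\subseteq W$, and let $\gamma\in\{-1,1\}^{V_U}$, $\lambda\in\{-1,1\}^{W_U}$ and partitions $\mathcal P$ of $V_U$ and $\mathcal Q$ of $W_U$ be generated by the unipolar parts of $(\widehat{\mathcal P},\widehat{\mathcal Q})$. Then $(\mathcal P,\mathcal Q,\gamma,\lambda,\delta,V_U,W_U)$ is a reflection reduction of $F(A,b,\ell,u,c)$.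
   Context: $V$ and $W$ are disjoint finite sets. $F(A,b,\ell,u,c)$ denotes the linear program $\min\{c^{\top}x : Ax=b,\ \ell\le x\le u\}$ with feasible region $P(A,b,\ell,u)$. Equitable partitions. For a matrix $M$ with rows $V$ and columns $W$, a partition $\mathcal P$ of $V$ and $\mathcal Q$ of $W$, $(\mathcal P,\mathcal Q)$ is equitable for $M$ if for all $P\in\mathcal P$, $Q\in\mathcal Q$: $\sum_{w\in Q}M_{v,w}=\sum_{w\in Q}M_{v',w}$ for all $v,v'\in P$, and $\sum_{v\in P}M_{v,w}=\sum_{v\in P}M_{v,w'}$ for all $w,w'\in Q$. A partition is an equitable partition of a vector if the vector is constant on each part. $(\mathcal P,\mathcal Q)$ is an equitable partition of a linear program $F(A,b,\ell,u,c)$ if it is equitable for $A$, $\mathcal P$ is an equitable partition of $b$, and $\mathcal Q$ is an equitable partition of $\ell$, $u$ and $c$. Split reformulation. For a linear program $F(A,b,\ell,u,c)$ with $\ell\le 0\le u$, $F_S(A,b,\ell,u,c)$ is the linear program in variables $x^+,x^-\in\mathbb{R}^W$: $\min c^{\top}x^+-c^{\top}x^-$ s.t. $Ax^+-Ax^-=b$, $-Ax^++Ax^-=-b$, $0\le x^+\le u$, $0\le x^-\le-\ell$. Its rows are indexed by $\widehat V$ and columns by $\widehat W$, consisting of two copies $v^+,v^-$ of each $v\in V$ and $w^+,w^-$ of each $w\in W$. For $P\subseteq V$ and signs $\gamma$, $P^{\gamma}=\{v^{+}:v\in P,\gamma_v=1\}\cup\{v^-:v\in P,\gamma_v=-1\}$;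 similarly $Q^\lambda$ for $Q\subseteq W$. A part of a partition of $\widehat V$ (resp. $\widehat W$) is bipolar if it contains both $v^+,v^-$ for some $v\in V$ (resp. $w^+,w^-$ for some $w\in W$), and unipolar otherwise (then it has the form $P^\gamma$, resp. $Q^\lambda$). $(\widehat{\mathcal P},\widehat{\mathcal Q})$ is symmetric if for every unipolar $P^{\gamma}\in\widehat{\mathcal P}$ also $P^{-\gamma}\in\widehat{\mathcal P}$, every bipolar part of $\widehat{\mathcal P}$ contains for each $v\in V$ both or none of $v^+,v^-$, and the same two conditions hold for $\widehat{\mathcal Q}$ and $W$. $V_U$ (resp. $W_U$) is the set of $v\in V$ (resp. $w\in W$) whose copies lie in unipolar parts, and $W_B=W\setminus W_U$. Generated data: $\gamma\in\{-1,1\}^{V_U}$ and a partition $\mathcal P$ of $V_U$ such that the set of unipolar parts of $\widehat{\mathcal P}$ is $\bigcup_{P\in\mathcal P}\{P^\gamma,P^{-\gamma}\}$, and $\lambda\in\{-1,1\}^{W_U}$ and a partition $\mathcal Q$ of $W_U$ such that the set of unipolar parts of $\widehat{\mathcal Q}$ is $\bigcup_{Q\in\mathcal Q}\{Q^\lambda,Q^{-\lambda}\}$. Partition matrices: for a partition $\mathcal P$ of a set $S$, $\Pi_{\mathcal P}\in\{0,1\}^{S\times\mathcal P}$ has $(\Pi_{\mathcal P})_{s,P}=1$ iff $s\in P$; $\widetilde{\Pi_{\mathcal P}}$ has entries $1/|P|$ if $s\in P$ and $0$ otherwise. Reflection reduction. Let $V_U\subseteq V$, $W_U\subseteq W$,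 $W_B=W\setminus W_U$, $\mathcal P$ a partition of $V_U$, $\mathcal Q$ a partition of $W_U$, $\gamma\in\{-1,1\}^{V_U}$, $\lambda\in\{-1,1\}^{W_U}$, $\delta\in\mathbb{R}^W$ with $\ell\le\delta\le u$; $\Gamma=\mathrm{diag}(\gamma)$, $\Lambda=\mathrm{diag}(\lambda)$. For $w\in W_U$ let $\ell^{\lambda,\delta}_w=\ell_w-\delta_w$ and $u^{\lambda,\delta}_w=u_w-\delta_w$ if $\lambda_w=1$, and $\ell^{\lambda,\delta}_w=\delta_w-u_w$ and $u^{\lambda,\delta}_w=\delta_w-\ell_w$ if $\lambda_w=-1$. Define $A'=\Pi_{\mathcal P}^{\top}\Gamma A_{V_U,W_U}\Lambda\widetilde{\Pi_{\mathcal Q}}$, $b'=\Pi_{\mathcal P}^{\top}\Gamma(b-A\delta)_{V_U}$, $\ell'=\Pi_{\mathcal Q}^{\top}\ell^{\lambda,\delta}_{W_U}$, $u'=\Pi_{\mathcal Q}^{\top}u^{\lambda,\delta}_{W_U}$, $c'=\widetilde{\Pi_{\mathcal Q}}^{\top}\Lambda c_{W_U}$. Then $(\mathcal P,\mathcal Q,\gamma,\lambda,\delta,V_U,W_U)$ is a reflection reduction of $F(A,b,\ell,u,c)$ if: (i) for every $x\in P(A,b,\ell,u)$, $y:=\Pi_{\mathcal Q}^{\top}\Lambda(x_{W_U}-\delta_{W_U})$ lies in $P(A',b',\ell',u')$ and $c^{\top}x=c'^{\top}y+c^{\top}\delta$; (ii) for every $y\in P(A',b',\ell',u')$, $x:=(\Lambda\widetilde{\Pi_{\mathcal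 Q}}y+\delta_{W_U},\ \delta_{W_B})$ lies in $P(A,b,\ell,u)$ and $c'^{\top}y+c^{\top}\delta=c^{\top}x$. *)

(* Defs.v *)
From mathcomp Require Import all_boot all_order all_algebra.
From mathcomp Require Import constructive_ereal reals.

Set Implicit Arguments.
Unset Strict Implicit.
Unset Printing Implicit Defensive.

Import Order.TTheory GRing.Theory Num.Theory.

Local Open Scope ring_scope.

(* min { c^T x : A x = b, l <= x <= u }, with rows indexed by V and columns
   by W. *)
Record lp (R : realType) (V W : finType) := LP {
  lp_A : V -> W -> R;
  lp_b : V -> R;
  lp_l : W -> \bar R;
  lp_u : W -> \bar R;
  lp_c : W -> R }.

Definition feasible (R : realType) (V W : finType) (F : lp R V W)
    (x : W -> R) : Prop :=
  (forall v, \sum_w lp_A F v w * x w = lp_b F v) /\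
  (forall w, (lp_l F w <= (x w)%:E <= lp_u F w)%E).

Definition dot (R : realType) (W : finType) (c x : W -> R) : R :=
  \sum_w c w * x w.

Definition equitable_mx (R : realType) (V W : finType) (M : V -> W -> R)
    (P : {set {set V}}) (Q : {set {set W}}) : Prop :=
  forall (B : {set V}) (C : {set W}), B \in P -> C \in Q ->
    {in B &, forall v v', \sum_(w in C) M v w = \sum_(w in C) M v' w} /\
    {in C &, forall w w', \sum_(v in B) M v w = \sum_(v in B) M v w'}.

Definition equitable_vec (T : finType) (E : Type) (P : {set {set T}})
    (f : T -> E) : Prop :=
  forall B : {set T}, B \in P -> {in B &, forall t t', f t = f t'}.

Definition equitable_lp (R : realType) (V W : finType) (F : lp R V W)
    (P : {set {set V}}) (Q : {set {set W}}) : Prop :=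
  [/\ partition P [set: V] /\ partition Q [set: W],
      equitable_mx (lp_A F) P Q,
      equitable_vec P (lp_b F),
      equitable_vec Q (lp_l F) /\ equitable_vec Q (lp_u F) &
      equitable_vec Q (lp_c F)].

(* F(A, b - A d, l - d, u - d, c) *)
Definition translate_lp (R : realType) (V W : finType) (F : lp R V W)
    (d : W -> R) : lp R V W :=
  LP (lp_A F)
     (fun v => lp_b F v - \sum_w lp_A F v w * d w)
     (fun w => lp_l F w - (d w)%:E)%E
     (fun w => lp_u F w - (d w)%:E)%E
     (lp_c F).

(* Two copies of each t : T, where t^+ is (t, true) and t^- is (t, false). *)
Notation copies T := (T * bool)%type (only parsing).

Definition sgb (R : realType) (s : bool) : R := if s then 1 else - 1.

Definition split_lp (R : realType) (V W : finType) (F : lp R V W) :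
    lp R (copies V) (copies W) :=
  LP (fun i j => sgb R i.2 * sgb R j.2 * lp_A F i.1 j.1)
     (fun i => sgb R i.2 * lp_b F i.1)
     (fun=> 0%E)
     (fun j => if j.2 then lp_u F j.1 else (- lp_l F j.1)%E)
     (fun j => sgb R j.2 * lp_c F j.1).

(* A vector indexed by a subset S of T is a function on T of which only the
   values on S are ever used. *)
Definition sign_on (R : realType) (T : finType) (S : {set T}) (g : T -> R) :
    Prop :=
  {in S, forall t, g t = 1 \/ g t = - 1}.

(* B^g = { t^+ : t in B, g t = 1 } U { t^- : t in B, g t = - 1 } *)
Definition signed_set (R : realType) (T : finType) (B : {set T})
    (g : T -> R) : {set copies T} :=
  [set z : copies T | (z.1 \in B) && (g z.1 == sgb R z.2)].

Definition bipolar (T : finType) (B : {set copies T}) : bool :=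
  [exists t : T, ((t, true) \in B) && ((t, false) \in B)].

Definition unipolar (T : finType) (B : {set copies T}) : bool := ~~ bipolar B.

Definition symmetric_partition (R : realType) (T : finType)
    (hP : {set {set copies T}}) : Prop :=
  (forall (B : {set T}) (g : T -> R), sign_on B g ->
     signed_set B g \in hP -> signed_set B (\- g) \in hP) /\
  (forall B : {set copies T}, B \in hP -> bipolar B ->
     forall t, ((t, true) \in B) = ((t, false) \in B)).

Definition unipolar_support (T : finType) (hP : {set {set copies T}}) :
    {set T} :=
  [set t | [forall s : bool, unipolar (pblock hP (t, s))]].

Definition generated_by_unipolar (R : realType) (T : finType)
    (hP : {set {set copies T}}) (TU : {set T}) (g : T -> R)
    (P : {set {set T}}) : Prop :=
  [/\ sign_on TU g,
      partition P TU &
      [set B in hP | unipolar B] =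
      \bigcup_(B in P) [set signed_set B g; signed_set B (\- g)]].

(* Entries (t, B) of the partition matrix of a partition containing B, and of
   its averaged version. *)
Definition part_mx (R : realType) (T : finType) (t : T) (B : {set T}) : R :=
  (t \in B)%:R.

Definition avg_mx (R : realType) (T : finType) (t : T) (B : {set T}) : R :=
  if t \in B then #|B|%:R^-1 else 0.

Definition refl_l (R : realType) (W : finType) (l u : W -> \bar R)
    (lam d : W -> R) (w : W) : \bar R :=
  if lam w == 1 then (l w - (d w)%:E)%E else ((d w)%:E - u w)%E.

Definition refl_u (R : realType) (W : finType) (l u : W -> \bar R)
    (lam d : W -> R) (w : W) : \bar R :=
  if lam w == 1 then (u w - (d w)%:E)%E else ((d w)%:E - l w)%E.

(* F(A', b', l', u', c'), whose rows and columns are indexed by the parts of P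
   and Q.  In l' and u' the product 0 * (+oo or -oo) is 0. *)
Definition reduced_lp (R : realType) (V W : finType) (F : lp R V W)
    (P : {set {set V}}) (Q : {set {set W}}) (gam : V -> R) (lam d : W -> R)
    (VU : {set V}) (WU : {set W}) :
    lp R {B : {set V} | B \in P} {C : {set W} | C \in Q} :=
  LP (fun B C => \sum_(v in VU) \sum_(w in WU)
        part_mx R v (val B) * gam v * lp_A F v w * lam w * avg_mx R w (val C))
     (fun B => \sum_(v in VU)
        part_mx R v (val B) * gam v * (lp_b F v - \sum_w lp_A F v w * d w))
     (fun C => \sum_(w in WU)
        (part_mx R w (val C))%:E * refl_l (lp_l F) (lp_u F) lam d w)%E
     (fun C => \sum_(w in WU)
        (part_mx R w (val C))%:E * refl_u (lp_l F) (lp_u F) lam d w)%E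
     (fun C => \sum_(w in WU) avg_mx R w (val C) * lam w * lp_c F w).

Definition refl_proj (R : realType) (W : finType) (Q : {set {set W}})
    (lam d : W -> R) (WU : {set W}) (x : W -> R)
    (C : {C : {set W} | C \in Q}) : R :=
  \sum_(w in WU) part_mx R w (val C) * lam w * (x w - d w).

Definition refl_lift (R : realType) (W : finType) (Q : {set {set W}})
    (lam d : W -> R) (WU : {set W}) (y : {C : {set W} | C \in Q} -> R)
    (w : W) : R :=
  if w \in WU then lam w * (\sum_C avg_mx R w (val C) * y C) + d w else d w.

Definition reflection_reduction (R : realType) (V W : finType) (F : lp R V W)
    (P : {set {set V}}) (Q : {set {set W}}) (gam : V -> R) (lam d : W -> R)
    (VU : {set V}) (WU : {set W}) : Prop :=
  let F' := reduced_lp F P Q gam lam d VU WU in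
  [/\ [/\ partition P VU, partition Q WU, sign_on VU gam, sign_on WU lam &
          forall w, (lp_l F w <= (d w)%:E <= lp_u F w)%E],
      forall x : W -> R, feasible F x ->
        let y := @refl_proj R W Q lam d WU x in
        feasible F' y /\
        dot (lp_c F) x = dot (lp_c F') y + dot (lp_c F) d &
      forall y : {C : {set W} | C \in Q} -> R, feasible F' y ->
        let x := @refl_lift R W Q lam d WU y in
        feasible F x /\
        dot (lp_c F') y + dot (lp_c F) d = dot (lp_c F) x].

(* Main.v *)
Require Import Defs.
From mathcomp Require Import all_boot all_order all_algebra.
From mathcomp Require Import constructive_ereal reals.

Set Implicit Arguments.
Unset Strict Implicit.
Unset Printing Implicit Defensive.

Import Order.TTheory GRing.Theory Num.Theory.

Local Open Scope ring_scope.

(* For a symmetric partition [hP], if the odd extension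
   [(t, s) |-> sgb s * f t] of [f] is constant on the parts of [hP], then [f]
   vanishes outside the unipolar support and [gam * f] is constant on each part
   of [P].  By equitability this applies to [c], to [b - A d], to the signed row
   sums of [A] over a part of [Q] and to its signed column sums over a part of
   [P].  The column sums show that aggregating a solution preserves [A x = b].
   For the converse, the residual of a lifted solution is again such an [f], and
   its signed sum over each part of [P] is zero, so it vanishes. *)

Definition odd_ext (R : realType) (T : finType) (f : T -> R) (z : copies T) : R :=
  sgb R z.2 * f z.1.

Lemma oppr1_eq1 (R : realType) : (- 1 == 1 :> R) = false.
Proof. by rewrite lt_eqF // (lt_trans _ ltr01) // oppr_lt0. Qed.

(** * Unipolar parts and odd extensions *)

Section SignedParts.
Variables (R : realType) (T : finType).
Implicit Types (B TU : {set T}) (f g : T -> R) (hP : {set {set copies T}}).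
Implicit Types (P : {set {set T}}).

Lemma sgb_sign (x : R) : x = 1 \/ x = - 1 -> sgb R (x == 1) = x.
Proof. by case=> ->; rewrite ?eqxx ?oppr1_eq1. Qed.

Lemma sign_onS B TU g : B \subset TU -> sign_on TU g -> sign_on B g.
Proof. by move=> /subsetP sBT gP t /sBT /gP. Qed.

Lemma sign_onN B g : sign_on B g -> sign_on B (\- g).
Proof. by move=> gP t /gP[] /= ->; [right | left; rewrite opprK]. Qed.

Lemma sign_on_sqr B g : sign_on B g -> {in B, forall t, g t * g t = 1}.
Proof. by move=> gP t /gP[] ->; rewrite ?mulrNN mulr1. Qed.

Lemma mem_signed_set B g t :
  sign_on B g -> t \in B -> (t, g t == 1) \in signed_set B g.
Proof. by move=> gP tB; rewrite inE /= tB sgb_sign ?eqxx //; apply: gP. Qed.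

(** A signed set holds exactly one copy of each [t] in [B], the one whose sign is [g t], so the sum
    reindexes over [B]. *)
Lemma sum_signed_set B g (F : copies T -> R) : sign_on B g ->
  \sum_(z in signed_set B g) F z = \sum_(t in B) F (t, g t == 1).
Proof.
move=> gP.
have -> : signed_set B g = [set (t, g t == 1) | t in B].
  apply/setP=> -[t s]; apply/idP/imsetP => /=.
    rewrite inE /= => /andP[tB /eqP gt]; exists t => //; congr (_, _).
    by case: s gt => ->; rewrite /sgb ?eqxx ?oppr1_eq1.
  by case=> t' t'B [-> ->]; apply: mem_signed_set.
by rewrite big_imset //= => t t' _ _ [].
Qed.

Lemma signed_part hP TU g P B : generated_by_unipolar hP TU g P -> B \in P ->
  signed_set B g \in hP /\ signed_set B (\- g) \in hP.
Proof.
case=> _ _ hU BP.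
have sub X : X \in [set signed_set B g; signed_set B (\- g)] -> X \in hP.
  move=> XB; suff : X \in [set B in hP | unipolar B] by rewrite inE => /andP[].
  by rewrite hU; apply/bigcupP; exists B.
by split; apply: sub; rewrite !inE eqxx ?orbT.
Qed.

Lemma part_sub hP TU g P B :
  generated_by_unipolar hP TU g P -> B \in P -> B \subset TU.
Proof. by case=> _ + _; apply: partitionS. Qed.

Lemma part_sign hP TU g P B :
  generated_by_unipolar hP TU g P -> B \in P -> sign_on B g.
Proof.
by move=> hg BP; have [gP _ _] := hg; apply: sign_onS (part_sub hg BP) gP.
Qed.

(** The part [signed_set B g] of [hP] contains [(t, g t == 1)], where the odd extension of [f] takes
    the value [g t * f t]. *)
Lemma odd_equitable_part hP TU g P f B : generated_by_unipolar hP TU g P ->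
  equitable_vec hP (odd_ext f) -> B \in P ->
  {in B &, forall t t', g t * f t = g t' * f t'}.
Proof.
move=> hg hf BP t t' tB t'B.
have gP := part_sign hg BP; have [gB _] := signed_part hg BP.
have := hf _ gB _ _ (mem_signed_set gP tB) (mem_signed_set gP t'B).
by rewrite /odd_ext /= !sgb_sign //; apply: gP.
Qed.

(* A bipolar part contains both copies of such a [t], so [f t = - f t]. *)
Lemma odd_equitable_bipolar hP f t : partition hP [set: copies T] ->
  symmetric_partition R hP -> equitable_vec hP (odd_ext f) ->
  t \notin unipolar_support hP -> f t = 0.
Proof.
move=> /cover_partition cP [_ hsym] hf.
rewrite inE negb_forall => /existsP[s]; rewrite negbK => bip.
have ts : (t, s) \in cover hP by rewrite cP inE.
have BP := pblock_mem ts; move: ts; rewrite -mem_pblock => ts.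
have [tT tF] : (t, true) \in pblock hP (t, s) /\ (t, false) \in pblock hP (t, s).
  by have := hsym _ BP bip t; case: s ts {bip BP} => -> => [<-|->].
have /eqP := hf _ BP _ _ tT tF.
rewrite /odd_ext /= mul1r mulN1r -subr_eq0 opprK -mulr2n -mulr_natl mulf_eq0.
by rewrite pnatr_eq0 /= => /eqP.
Qed.

End SignedParts.

(** * Signed row and column sums of the matrix *)

Section Matrices.
Variables (R : realType) (V W : finType) (A : V -> W -> R).
Variables (hP : {set {set copies V}}) (hQ : {set {set copies W}}).
Hypothesis hA :
  equitable_mx (fun i j => sgb R i.2 * sgb R j.2 * A i.1 j.1) hP hQ.

(** Row [i] of the split matrix, summed over the part [signed_set C lam], is [sgb R i.2] times a
    signed row sum of [A]; the row condition for this part is then the claim. *)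
Lemma equitable_row_sum WU lam Q C :
  generated_by_unipolar hQ WU lam Q -> C \in Q ->
  equitable_vec hP (odd_ext (fun v => \sum_(w in C) lam w * A v w)).
Proof.
move=> hg CQ B BP i i' iB i'B.
have lP := part_sign hg CQ; have [lC _] := signed_part hg CQ.
have [/(_ i i' iB i'B) + _] := hA BP lC.
rewrite !sum_signed_set // /odd_ext /= !mulr_sumr => h.
have dist k : \sum_(w in C) sgb R k.2 * sgb R (lam w == 1) * A k.1 w =
    \sum_(w in C) sgb R k.2 * (lam w * A k.1 w).
  by apply: eq_bigr => w wC; rewrite sgb_sign ?mulrA //; apply: lP.
by rewrite -!dist.
Qed.

(** Dual argument: the column condition for the part [signed_set B gam]. *)
Lemma equitable_col_sum VU gam P B :
  generated_by_unipolar hP VU gam P -> B \in P ->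
  equitable_vec hQ (odd_ext (fun w => \sum_(v in B) gam v * A v w)).
Proof.
move=> hg BP C CQ j j' jC j'C.
have gP := part_sign hg BP; have [gB _] := signed_part hg BP.
have [_ /(_ j j' jC j'C)] := hA gB CQ.
rewrite !sum_signed_set // /odd_ext /= !mulr_sumr => h.
have dist k : \sum_(v in B) sgb R (gam v == 1) * sgb R k.2 * A v k.1 =
    \sum_(v in B) sgb R k.2 * (gam v * A v k.1).
  apply: eq_bigr => v vB.
  by rewrite sgb_sign ?mulrA 1?[_ * sgb R _]mulrC //; apply: gP.
by rewrite -!dist.
Qed.

End Matrices.

(** * Averages over parts, aggregation and lifting *)

Section Sums.
Variables (R : realType) (T : finType).
Implicit Types (B C TU : {set T}) (Q : {set {set T}}) (F lam q z : T -> R).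

Lemma sum_part_mx C TU F : C \subset TU ->
  \sum_(w in TU) part_mx R w C * F w = \sum_(w in C) F w.
Proof.
move=> /subsetP sCT; rewrite big_mkcond [RHS]big_mkcond /=.
apply: eq_bigr => w _; rewrite /part_mx.
by case: (boolP (w \in C)) => [/sCT ->|_]; rewrite ?mul1r ?mul0r ?if_same.
Qed.

Lemma sum_part_mxE C TU (F : T -> \bar R) : C \subset TU ->
  (\sum_(w in TU) (part_mx R w C)%:E * F w = \sum_(w in C) F w)%E.
Proof.
move=> /subsetP sCT; rewrite big_mkcond [RHS]big_mkcond /=.
apply: eq_bigr => w _; rewrite /part_mx.
by case: (boolP (w \in C)) => [/sCT ->|_]; rewrite ?mul1e ?mul0e ?if_same.
Qed.

Lemma avg_mxE w C : avg_mx R w C = part_mx R w C * #|C|%:R^-1.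
Proof. by rewrite /avg_mx /part_mx; case: ifP; rewrite ?mul1r ?mul0r. Qed.

Lemma sum_avg_mx C TU F : C \subset TU ->
  \sum_(w in TU) avg_mx R w C * F w = #|C|%:R^-1 * \sum_(w in C) F w.
Proof.
move=> sCT; rewrite -(sum_part_mx _ sCT) mulr_sumr; apply: eq_bigr => w _.
by rewrite avg_mxE mulrAC [RHS]mulrC.
Qed.

Lemma sum_parts Q TU F : partition Q TU ->
  \sum_(w in TU) F w = \sum_(C : {C | C \in Q}) \sum_(w in val C) F w.
Proof. by move=> hQ; rewrite (set_partition_big _ hQ) /= big_sub. Qed.

Lemma card_part_neq0 Q TU C : partition Q TU -> C \in Q -> #|C|%:R != 0 :> R.
Proof.
move=> hQ CQ; rewrite pnatr_eq0 cards_eq0; apply: contraTneq CQ => ->.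
by have [] := and3P hQ.
Qed.

(** On a part, [lam w * q w] is constant and hence equal to its average; the two factors [lam w]
    then cancel. With [z = x - d] this handles the constraints, where [q] is a signed column sum,
    and the objective, where [q] is [c]. *)
Lemma sum_aggregate Q TU lam q z : partition Q TU -> sign_on TU lam ->
  (forall C, C \in Q -> {in C &, forall w w', lam w * q w = lam w' * q w'}) ->
  (forall w, w \notin TU -> q w = 0) ->
  \sum_(C : {C | C \in Q}) (#|val C|%:R^-1 * \sum_(w in val C) lam w * q w) *
    (\sum_(w in val C) lam w * z w) = \sum_w q w * z w.
Proof.
move=> hQ lP qc q0.
rewrite [RHS](bigID (mem TU)) /= [X in _ + X]big1 ?addr0; last first.
  by move=> w /q0 ->; rewrite mul0r.
rewrite (sum_parts _ hQ); apply: eq_bigr => -[C CQ] _ /=.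
have sCT := partitionS hQ CQ.
rewrite [LHS]mulr_sumr; apply: eq_bigr => w wC.
rewrite (eq_bigr (fun _ => lam w * q w)); last by move=> w' w'C; apply: (qc C CQ).
rewrite sumr_const -(mulr_natl (lam w * q w)) mulKf ?(card_part_neq0 hQ) //.
rewrite mulrACA (sign_on_sqr lP) ?mul1r //.
by have /subsetP := sCT; apply.
Qed.

(** Exchanging the sums moves the averaging from [y] to [q]. Here [q] is arbitrary, so a single row
    of [A] is allowed. *)
Lemma sum_lift Q TU lam d q (y : {C | C \in Q} -> R) : partition Q TU ->
  \sum_w q w * (refl_lift lam d TU y w - d w) =
  \sum_(C : {C | C \in Q}) (#|val C|%:R^-1 * \sum_(w in val C) lam w * q w) * y C.
Proof.
move=> hQ.
rewrite [LHS](bigID (mem TU)) /= [X in _ + X]big1 ?addr0; last first.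
  by move=> w /negPf wT; rewrite /refl_lift wT subrr mulr0.
under eq_bigr => w wT.
  rewrite /refl_lift wT addrK mulrA mulr_sumr.
  under eq_bigr => C _ do rewrite mulrA.
  over.
rewrite exchange_big /=; apply: eq_bigr => -[C CQ] _ /=.
have sCT := partitionS hQ CQ.
rewrite -mulr_suml -(sum_avg_mx _ sCT); congr (_ * _).
by apply: eq_bigr => w _; rewrite mulrC [q w * _]mulrC.
Qed.

(** Parts are disjoint, so only the summand of the part containing [w] survives. *)
Lemma refl_lift_part Q TU lam d (y : {C | C \in Q} -> R)
    (C : {C | C \in Q}) w :
  partition Q TU -> w \in val C ->
  refl_lift lam d TU y w = lam w * (#|val C|%:R^-1 * y C) + d w.
Proof.
move=> hQ wC; rewrite /refl_lift.
have sCT := partitionS hQ (valP C).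
rewrite (subsetP sCT) // (bigD1 C) //= big1 => [|D DC].
  by rewrite addr0 /avg_mx wC.
rewrite /avg_mx; case: ifP => [wD|_]; last by rewrite mul0r.
have [_ tQ _] := and3P hQ; case/eqP: DC; apply: val_inj => /=.
by rewrite -(def_pblock tQ (valP C) wC) (def_pblock tQ (valP D) wD).
Qed.

End Sums.

(** * Reflected bounds *)

Section Bounds.
Variables (R : realType) (W : finType).
Implicit Types (l u : W -> \bar R) (lam d x : W -> R) (w : W).
Local Open Scope ereal_scope.

(** For [lam w = - 1] the reflection reverses the order, which the exchanged roles of [l] and [u]
    compensate. *)
Lemma refl_bounds l u lam d w (x : R) : (lam w = 1 \/ lam w = - 1)%R ->
  (refl_l l u lam d w <= (lam w * (x - d w))%:E <= refl_u l u lam d w) =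
  (l w <= x%:E <= u w).
Proof.
rewrite /refl_l /refl_u => -[] lw.
  rewrite lw eqxx mul1r EFinB.
  by rewrite leeD2rE // leeD2rE.
rewrite lw oppr1_eq1.
by rewrite mulN1r opprB EFinB !leeD2lE // !leeN2 andbC.
Qed.

(** The upper bounds of the split program encode both: the copy of [w] with sign [lam w] carries
    [refl_u], the opposite copy carries the negative of [refl_l]. Hence both [signed_set C lam] and
    [signed_set C (\- lam)] are used. *)
Lemma equitable_refl_bounds (V : finType) (A : V -> W -> R) b l u c d hQ WU
    lam Q C :
  let F := split_lp (translate_lp (LP A b l u c) d) in
  equitable_vec hQ (lp_u F) -> generated_by_unipolar hQ WU lam Q -> C \in Q ->
  {in C &, forall w w', refl_l l u lam d w = refl_l l u lam d w' /\
                        refl_u l u lam d w = refl_u l u lam d w'}.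
Proof.
move=> F hF hg CQ w w' wC w'C.
have lP := part_sign hg CQ; have [lC lNC] := signed_part hg CQ.
have ub v : v \in C -> lp_u F (v, lam v == 1)%R = refl_u l u lam d v.
  move=> vC; rewrite /refl_u /=; case: eqP => //= _.
  (* Since [d v] is finite, negation distributes even when [l v] is infinite. *)
  by rewrite EFinN fin_num_oppeB // addeC.
have lb v : v \in C -> lp_u F (v, (\- lam)%R v == 1)%R = - refl_l l u lam d v.
  move=> vC; rewrite /refl_l /=.
  case: (lP v vC) => ->; rewrite ?opprK ?eqxx ?oppr1_eq1 //.
  by rewrite [X in - X]addeC fin_num_oppeD // oppeK.
split.
  apply: oppe_inj; rewrite -!lb //.
  by apply: (hF _ lNC); apply: mem_signed_set => //; apply: sign_onN.
by rewrite -!ub //; apply: (hF _ lC); apply: mem_signed_set.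
Qed.

End Bounds.

Theorem theorem19 (R : realType) (V W : finType)
    (A : V -> W -> R) (b : V -> R) (l u : W -> \bar R) (c d : W -> R)
    (hl : forall w, l w <> +oo%E) (hu : forall w, u w <> -oo%E)
    (hlu : forall w, (l w <= u w)%E)
    (hd : forall w, (l w <= (d w)%:E <= u w)%E)
    (hP : {set {set copies V}}) (hQ : {set {set copies W}})
    (hequit : equitable_lp (split_lp (translate_lp (LP A b l u c) d)) hP hQ)
    (hsymV : symmetric_partition R hP) (hsymW : symmetric_partition R hQ)
    (VU : {set V}) (WU : {set W})
    (hVU : VU = unipolar_support hP) (hWU : WU = unipolar_support hQ)
    (gam : V -> R) (lam : W -> R)
    (P : {set {set V}}) (Q : {set {set W}})
    (hgenV : generated_by_unipolar hP VU gam P)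
    (hgenW : generated_by_unipolar hQ WU lam Q) :
  reflection_reduction (LP A b l u c) P Q gam lam d VU WU.
Proof.
have [[pV pW] hA hb [_ hub] hc] := hequit.
have [gP pP _] := hgenV; have [lP pQ _] := hgenW.
pose r w := b w - \sum_w' A w w' * d w'.
(* The split right-hand side and costs are by definition the odd extensions of [r] and [c]. *)
have hr : equitable_vec hP (odd_ext r) by [].
have hcc : equitable_vec hQ (odd_ext c) by [].
pose q (B : {set V}) w := \sum_(v in B) gam v * A v w.
have A'E B C : lp_A (reduced_lp (LP A b l u c) P Q gam lam d VU WU) B C =
    #|val C|%:R^-1 * \sum_(w in val C) lam w * q (val B) w.
  rewrite /= exchange_big /= -(sum_avg_mx _ (partitionS pQ (valP C))).
  apply: eq_bigr => w _; rewrite /q.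
  rewrite -(sum_part_mx _ (partitionS pP (valP B))) !mulr_sumr.
  by apply: eq_bigr => v _; rewrite mulrC [_ * lam w]mulrC -!mulrA.
have b'E B : lp_b (reduced_lp (LP A b l u c) P Q gam lam d VU WU) B =
    \sum_(v in val B) gam v * r v.
  rewrite /= -(sum_part_mx _ (partitionS pP (valP B))).
  by apply: eq_bigr => v _; rewrite mulrA.
have c'E C : lp_c (reduced_lp (LP A b l u c) P Q gam lam d VU WU) C =
    #|val C|%:R^-1 * \sum_(w in val C) lam w * c w.
  rewrite /= -(sum_avg_mx _ (partitionS pQ (valP C))).
  by apply: eq_bigr => w _; rewrite mulrA.
have l'E C : lp_l (reduced_lp (LP A b l u c) P Q gam lam d VU WU) C =
    (\sum_(w in val C) refl_l l u lam d w)%E.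
  exact: sum_part_mxE (partitionS pQ (valP C)).
have u'E C : lp_u (reduced_lp (LP A b l u c) P Q gam lam d VU WU) C =
    (\sum_(w in val C) refl_u l u lam d w)%E.
  exact: sum_part_mxE (partitionS pQ (valP C)).
have sub_dot (f x : W -> R) :
    \sum_w f w * (x w - d w) = \sum_w f w * x w - \sum_w f w * d w.
  by rewrite -sumrB; apply: eq_bigr => w _; rewrite mulrBr.
have col_dot B (x : W -> R) :
    \sum_w q B w * x w = \sum_(v in B) gam v * \sum_w A v w * x w.
  under eq_bigr do rewrite mulr_suml.
  rewrite exchange_big; apply: eq_bigr => v _ /=; rewrite mulr_sumr.
  by apply: eq_bigr => w _; rewrite mulrA.
split=> // [x [xA xb] y|y [yA yb] x].
  have yE C : y C = \sum_(w in val C) lam w * (x w - d w).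
    rewrite /y /refl_proj -(sum_part_mx _ (partitionS pQ (valP C))).
    by apply: eq_bigr => w _; rewrite mulrA.
  split; first split=> [B|C].
  (* Row [B] of the reduced system becomes the [gam]-signed sum over [B] of the rows of
     [A (x - d) = r]. *)
  - under eq_bigr => C _ do rewrite A'E yE.
    have hq := equitable_col_sum hA hgenV (valP B).
    rewrite (sum_aggregate (q := q (val B)) (fun w => x w - d w) pQ lP);
      last 2 first.
    + by move=> C CQ; apply: odd_equitable_part hgenW hq CQ.
    + by move=> w; rewrite hWU; apply: odd_equitable_bipolar pW hsymW hq.
    rewrite col_dot b'E; apply: eq_bigr => v _.
    by rewrite sub_dot xA.
  - rewrite l'E u'E yE -sumEFin.
    (* The reflected bounds hold for each [w] and are added up over the part. *)
    apply/andP; split; apply: lee_sum => w wC;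
      have := refl_bounds l u d (x w) (part_sign hgenW (valP C) wC);
      by rewrite xb => /andP[].
  - rewrite /dot; under [in RHS]eq_bigr => C _ do rewrite c'E yE.
    rewrite (sum_aggregate (q := c) (fun w => x w - d w) pQ lP); last 2 first.
    + by move=> C CQ; apply: odd_equitable_part hgenW hcc CQ.
    + by move=> w; rewrite hWU; apply: odd_equitable_bipolar pW hsymW hcc.
    by rewrite sub_dot subrK.
(* Applied below to the rows of [A], to [q B] and to [c]. *)
have xq f : \sum_w f w * x w - \sum_w f w * d w =
    \sum_(C : {C | C \in Q})
      (#|val C|%:R^-1 * \sum_(w in val C) lam w * f w) * y C.
  by rewrite -sub_dot (sum_lift _ _ _ _ pQ).
split; first split.
- pose e v := \sum_w A v w * x w - b v.
  have eE v : e v =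
      \sum_(C : {C | C \in Q}) (#|val C|%:R^-1 * \sum_(w in val C) lam w * A v w)
        * y C - r v.
    by rewrite -xq /e /r opprB addrA subrK.
  (* By [eE], [e] is a linear combination of signed row sums minus [r], and all of these have
     equitable odd extensions. *)
  have he : equitable_vec hP (odd_ext e).
    move=> B BP i j iB jB; rewrite /odd_ext !eE !mulrBr.
    congr (_ - _); last by rewrite -!mulrBr; apply: hr BP i j iB jB.
    rewrite !mulr_sumr; apply: eq_bigr => C _.
    rewrite ![_ * (_ * y C)]mulrA ![sgb R _ * (_ * _)]mulrCA; congr (_ * _ * _).
    exact: (equitable_row_sum hA hgenW (valP C)) BP _ _ iB jB.
  move=> v /=; apply/eqP; rewrite -subr_eq0 -/(e v).
  case: (boolP (v \in VU)) => [vU|]; last first.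
    by rewrite hVU => /(odd_equitable_bipolar pV hsymV he) ->.
  have vc : v \in cover P by rewrite (cover_partition pP).
  have BP := pblock_mem vc; move: vc; rewrite -mem_pblock => vB.
  set B := pblock P v in BP vB.
  (* This is row [B] of the reduced system, which [y] satisfies. *)
  have sum0 : \sum_(t in B) gam t * e t = 0.
    have := yA (exist _ B BP); rewrite b'E.
    under eq_bigr do rewrite A'E.
    rewrite -xq !col_dot -sumrB => /eqP; rewrite -subr_eq0 -sumrB => /eqP.
    apply: etrans; apply: eq_bigr => t _.
    by rewrite -!mulrBr /e /r /= opprB addrA subrK.
  (* The summands are constant on [B], so the zero sum forces [gam v * e v = 0], and [gam v] squares
     to 1. *)
  have : \sum_(t in B) gam t * e t = #|B|%:R * (gam v * e v).
    rewrite (eq_bigr (fun _ => gam v * e v)) ?sumr_const ?mulr_natl // => t tB.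
    exact: odd_equitable_part hgenV he BP _ _ tB vB.
  rewrite sum0 => /esym /eqP; rewrite mulf_eq0 (negPf (card_part_neq0 _ pP BP)) /=.
  move=> /eqP ge0; rewrite -[e v]mul1r -(sign_on_sqr gP vU) -mulrA ge0 mulr0.
  exact: eqxx.
(* Off [WU] the lift equals [d], which respects the bounds by [hd]. *)
- move=> w /=; case: (boolP (w \in WU)) => [wU|wU]; last first.
    by rewrite /x /refl_lift (negPf wU).
  have wc : w \in cover Q by rewrite (cover_partition pQ).
  have CQ := pblock_mem wc; move: wc; rewrite -mem_pblock => wC.
  set C := pblock Q w in CQ wC.
  have lw := lP _ wU.
  (* Reflected, the value at [w] is [y C] divided by [#|C|]. The reflected bounds are constant on
     [C], so the bounds on [y C] are [#|C|] times those at [w], and dividing by [#|C|] concludes. *)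
  rewrite -(refl_bounds l u d (x w) lw) /x.
  rewrite (refl_lift_part lam d y (C := exist _ C CQ) pQ wC).
  rewrite addrK mulrA (sign_on_sqr lP) // mul1r /=.
  have := yb (exist _ C CQ); rewrite l'E u'E /=.
  have const := equitable_refl_bounds hub hgenW CQ.
  have C0 : 0 < #|C|%:R :> R by rewrite lt0r (card_part_neq0 _ pQ CQ) ler0n.
  have sum_const (f : W -> \bar R) : {in C, forall t, f t = f w} ->
      (\sum_(t in C) f t = #|C|%:R%:E * f w)%E.
    by move=> fw; rewrite (eq_bigr _ fw) GRing.sumr_const mule_natl.
  rewrite !sum_const => [|t tC|t tC]; try by have [] := const t w tC wC.
  by rewrite EFinM lee_pdivlMl // lee_pdivrMl.
- rewrite /dot; under eq_bigr do rewrite c'E.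
  by rewrite -xq subrK.
Qed.
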